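(* Let $R$ be a commutative ring, $\mathcal C$ a poset, and $M$ an $S$-presented $R\mathcal C$-module, where $S\subseteq\mathcal C$ is Artinian. Then $M$ is $(B_S(M)\cup D_S(M))$-presented. Furthermore, $B_S(M)\cup D_S(M)$ is the minimum element (with respect to inclusion) of the set $\{T\subseteq S\mid M\text{ is }T\text{-presented}\}$.
   Context: A poset $\mathcal C$ is regarded as a category with a unique morphism $c\to d$ iff $c\le d$. An $R\mathcal C$-module is a functor $M\colon\mathcal C\to R\text{-}\mathbf{Mod}$; exactness is pointwise. For $T\subseteq\mathcal C$, $M$ is $T$-presented if the canonical map $\mathrm{colim}_{d\in T,\,d\le c}M(d)\to M(c)$ is an isomorphism for all $c\in\mathcal C$; equivalently, there is an exact sequence $\bigoplus_{s\in T}B_s[\mathrm{Mor}_{\mathcal C}(s,-)]\to\bigoplus_{s\in T}A_s[\mathrm{Mor}_{\mathcal C}(s,-)]\to M\to0$ with $R$-modules $A_s,B_s$, where $A[\mathrm{Mor}_{\mathcal C}(s,-)]=A\otimes_RR[\mathrm{Mor}_{\mathcal C}(s,-)]$ pointwise. For $c\in\mathcal C$, let $\lambda_{M,c}\colon\mathrm{colim}_{d<c,\ d\in S}M(d)\to M(c)$ be the natural homomorphism. $B_S(M)=\{c\in\mathcal C\mid\lambda_{M,c}\text{ is not an epimorphism}\}$ and $D_S(M)=\{c\in\mathcal C\mid\lambda_{M,c}\text{ is not a monomorphism}\}$. A poset is Artinian if it has no infinite strictly descending chains, equivalently if every non-empty subset has a minimal element. *)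

(* Defs.v *)
From HB Require Import structures.
From mathcomp Require Import all_boot all_order all_algebra.
From mathcomp Require Import generic_quotient ring_quotient.
From mathcomp Require Import boolp classical_sets functions cardinality fsbigop.

Set Implicit Arguments.
Unset Strict Implicit.
Unset Printing Implicit Defensive.

Import Order.TTheory GRing.Theory.
Local Open Scope classical_set_scope.
Local Open Scope ring_scope.

Section Span.
Variables (R : pzRingType) (V : lmodType R) (G : set V).

Definition lmod_span : {pred V} := fun v =>
  `[< forall K : {pred V}, submod_closed K -> {in G, forall g, g \in K} -> v \in K >].

Fact lmod_span_closed : submod_closed lmod_span.
Proof.
split=> [|a u v /asboolP hu /asboolP hv]; apply/asboolP => K clK GK.
  by case: clK.
by case: (clK) => _ KD; apply: KD; [apply: hu | apply: hv].
Qed.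
HB.instance Definition _ :=
  GRing.isSubmodClosed.Build R V lmod_span lmod_span_closed.

Lemma lmod_span_gen g : G g -> g \in lmod_span.
Proof. by move=> Gg; apply/asboolP => K _; apply; rewrite inE. Qed.
End Span.

Section QuotientModule.
Variables (R : pzRingType) (V : lmodType R) (G : set V).
Local Open Scope quotient_scope.

Definition lmod_quot : Type := Quotient.quot (lmod_span G).
HB.instance Definition _ := GRing.Zmodule.on lmod_quot.

Definition lmod_pi (x : V) : lmod_quot := \pi_(Quotient.quot (lmod_span G)) x.

Definition lmod_quot_scale (a : R) (q : lmod_quot) : lmod_quot :=
  lmod_pi (a *: repr (q : Quotient.quot (lmod_span G))).

Lemma lmod_piK q : lmod_pi (repr (q : Quotient.quot (lmod_span G))) = q.
Proof. exact: reprK. Qed.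

Lemma lmod_pi_eq x y : (lmod_pi x = lmod_pi y) <-> x - y \in lmod_span G.
Proof. by rewrite Quotient.idealrBE; split=> /eqP. Qed.

Lemma lmod_piD : {morph lmod_pi : x y / x + y}.
Proof. by move=> x y; rewrite /lmod_pi raddfD. Qed.

Lemma lmod_pi_scale a x : lmod_quot_scale a (lmod_pi x) = lmod_pi (a *: x).
Proof.
apply/lmod_pi_eq; rewrite -scalerBr rpredZ //.
by apply/lmod_pi_eq; rewrite lmod_piK.
Qed.

Fact lmod_quot_scaleA a b q :
  lmod_quot_scale a (lmod_quot_scale b q) = lmod_quot_scale (a * b) q.
Proof. by rewrite -[q]lmod_piK !lmod_pi_scale scalerA. Qed.
Fact lmod_quot_scale1 : left_id 1 lmod_quot_scale.
Proof. by move=> q; rewrite -[q]lmod_piK lmod_pi_scale scale1r. Qed.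
Fact lmod_quot_scaleDr : right_distributive lmod_quot_scale +%R.
Proof.
move=> a q r; rewrite -[q]lmod_piK -[r]lmod_piK -lmod_piD !lmod_pi_scale.
by rewrite scalerDr lmod_piD.
Qed.
Fact lmod_quot_scaleDl q : {morph lmod_quot_scale^~ q : a b / a + b}.
Proof. by move=> a b /=; rewrite -[q]lmod_piK !lmod_pi_scale scalerDl lmod_piD. Qed.

HB.instance Definition _ := GRing.Zmodule_isLmodule.Build R lmod_quot
  lmod_quot_scaleA lmod_quot_scale1 lmod_quot_scaleDr lmod_quot_scaleDl.

Fact lmod_pi_linear : linear lmod_pi.
Proof. by move=> a x y; rewrite lmod_piD -lmod_pi_scale. Qed.
HB.instance Definition _ :=
  GRing.isLinear.Build R V lmod_quot *:%R lmod_pi lmod_pi_linear.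

End QuotientModule.

Section DirectSum.
Variables (R : pzRingType) (I : choiceType) (M : I -> lmodType R).

Definition dprod : Type := forall i, M i.
HB.instance Definition _ := Choice.on dprod.
Implicit Types x y z : dprod.

Let zero : dprod := fun i => 0.
Let opp x : dprod := fun i => - x i.
Let add x y : dprod := fun i => x i + y i.
Let scale a x : dprod := fun i => a *: x i.

Let addA : associative add.
Proof. by move=> x y z; apply: functional_extensionality_dep => i; exact: addrA. Qed.
Let addC : commutative add.
Proof. by move=> x y; apply: functional_extensionality_dep => i; exact: addrC. Qed.
Let add0 : left_id zero add.
Proof. by move=> x; apply: functional_extensionality_dep => i; exact: add0r. Qed.
Let addN : left_inverse zero opp add.
Proof. by move=> x; apply: functional_extensionality_dep => i; exact: addNr. Qed.
HB.instance Definition _ := GRing.isZmodule.Build dprod addA addC add0 addN.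

Let scaleA a b x : scale a (scale b x) = scale (a * b) x.
Proof. by apply: functional_extensionality_dep => i; exact: scalerA. Qed.
Let scale1 : left_id 1 scale.
Proof. by move=> x; apply: functional_extensionality_dep => i; exact: scale1r. Qed.
Let scaleDr : right_distributive scale +%R.
Proof. by move=> a x y; apply: functional_extensionality_dep => i; exact: scalerDr. Qed.
Let scaleDl x : {morph scale^~ x : a b / a + b}.
Proof. by move=> a b; apply: functional_extensionality_dep => i; exact: scalerDl. Qed.
HB.instance Definition _ :=
  GRing.Zmodule_isLmodule.Build R dprod scaleA scale1 scaleDr scaleDl.

Lemma dprodE a x y i : (a *: x + y : dprod) i = a *: x i + y i.
Proof. by []. Qed.

Definition finsupp : {pred dprod} := fun x => `[< finite_set [set i | x i != 0] >].

Fact finsupp_closed : submod_closed finsupp.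
Proof.
split=> [|a x y /asboolP fx /asboolP fy]; apply/asboolP.
  by apply: (@sub_finite_set _ _ set0) => // i /=; rewrite eqxx.
apply: (@sub_finite_set _ _ ([set i | x i != 0] `|` [set i | y i != 0])).
  move=> i /=; rewrite dprodE.
  apply: contraNP => /not_orP[/negP/negPn/eqP-> /negP/negPn/eqP->].
  by rewrite scaler0 addr0.
by rewrite finite_setU.
Qed.
HB.instance Definition _ :=
  GRing.isSubmodClosed.Build R dprod finsupp finsupp_closed.

Definition dsum : Type := {x : dprod | x \in finsupp}.
HB.instance Definition _ := SubChoice.on dsum.
HB.instance Definition _ := [SubChoice_isSubLmodule of dsum by <:].

Fact dsum_in_subproof i (v : M i) : (dfwith (0 : dprod) v : dprod) \in finsupp.
Proof.
apply/asboolP; apply: (@sub_finite_set _ _ [set i]) => // j /=.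
by case: dfwithP => // k _; rewrite eqxx.
Qed.
Definition dsum_in i (v : M i) : dsum := exist (fun x : dprod => x \in finsupp) _ (dsum_in_subproof v).

Fact dsum_in_linear i : linear (@dsum_in i).
Proof.
move=> a u v; apply: val_inj; apply: functional_extensionality_dep => j /=.
rewrite dprodE.
have [<-|ne] := eqVneq i j; first by rewrite !dfwith_in.
by rewrite !dfwith_out // scaler0 addr0.
Qed.
HB.instance Definition _ i :=
  GRing.isLinear.Build R (M i) dsum *:%R (@dsum_in i) (@dsum_in_linear i).

Section Desc.
Variables (N : lmodType R) (f : forall i, {linear M i -> N}).

Definition dsum_desc (x : dsum) : N :=
  \sum_(i \in [set: I]) f i (val x i).

Lemma dsum_desc_supp (x : dsum) (A : set I) : finite_set A ->
  [set i | val x i != 0] `<=` A ->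
  dsum_desc x = \sum_(i \in A) f i (val x i).
Proof.
move=> Af sA; rewrite /dsum_desc; apply/esym/fsbig_widen => // i /= [_ Ai].
have [->|ne0] := eqVneq (val x i) 0; first by rewrite linear0.
by case: Ai; apply: sA.
Qed.

Fact dsum_desc_linear : linear dsum_desc.
Proof.
move=> a x y.
have finx : finite_set [set i | val x i != 0] by apply/asboolP; case: (x).
have finy : finite_set [set i | val y i != 0] by apply/asboolP; case: (y).
set A := [set i | val x i != 0] `|` [set i | val y i != 0].
have Af : finite_set A by rewrite finite_setU.
rewrite (@dsum_desc_supp x A) //; last by move=> i; left.
rewrite (@dsum_desc_supp y A) //; last by move=> i; right.
rewrite (@dsum_desc_supp _ A) //; last first.
  move=> i /=; rewrite dprodE.
  apply: contraNP => /not_orP[/negP/negPn/eqP-> /negP/negPn/eqP->].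
  by rewrite scaler0 addr0.
rewrite !fsbig_finite //= scaler_sumr -big_split /=; apply: eq_bigr => i _.
by rewrite -linearP.
Qed.
HB.instance Definition _ :=
  GRing.isLinear.Build R dsum N *:%R dsum_desc dsum_desc_linear.

Lemma dsum_desc_in i (v : M i) : dsum_desc (dsum_in v) = f i v.
Proof.
rewrite (@dsum_desc_supp _ [set i]) ?fsbig_set1 /= ?dfwith_in // => j /=.
by case: dfwithP => // k _; rewrite eqxx.
Qed.
End Desc.

Lemma dsum_sum_in (x : dsum) :
  x = \sum_(i <- finmap.enum_fset (fset_set [set i | val x i != 0])) dsum_in (val x i).
Proof.
have fin : finite_set [set i | val x i != 0] by apply/asboolP; case: (x).
have ev (s : seq I) (F : I -> dsum) j :
    val (\sum_(i <- s) F i) j = \sum_(i <- s) val (F i) j.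
  by elim: s => [|i s IH]; rewrite ?big_nil ?big_cons //= -IH.
apply: val_inj; apply: functional_extensionality_dep => j; rewrite ev.
have [xj0|xj0] := eqVneq (val x j) 0.
  rewrite big1_seq // => i /andP[_]; rewrite in_fset_set // inE /= => xi0.
  by rewrite dfwith_out //; apply: contra_neq xi0 => ->.
rewrite (bigD1_seq j) ?finmap.fset_uniq //=; last by rewrite in_fset_set ?inE.
rewrite dfwith_in big1 ?addr0 // => i ne.
by rewrite dfwith_out.
Qed.

Lemma dsum_ext (N : lmodType R) (g h : {linear dsum -> N}) :
  (forall i (v : M i), g (dsum_in v) = h (dsum_in v)) -> g =1 h.
Proof.
move=> gh x; rewrite [x]dsum_sum_in !linear_sum.
by apply: eq_bigr => i _; exact: gh.
Qed.

End DirectSum.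

(* The functor laws quantify over the order proofs, all of which are equal. *)
Record pmodule (R : pzRingType) (disp : Order.disp_t) (C : porderType disp) :=
PModule {
  pm_obj :> C -> lmodType R;
  pm_map : forall c d : C, (c <= d)%O -> {linear pm_obj c -> pm_obj d};
  pm_map_id : forall (c : C) (h : (c <= c)%O) x, pm_map h x = x;
  pm_map_comp : forall (a b c : C)
    (ab : (a <= b)%O) (bc : (b <= c)%O) (ac : (a <= c)%O) x,
    pm_map ac x = pm_map bc (pm_map ab x)
}.

(* The colimit over the full subposet P is the cokernel of the usual map
   \bigoplus_(i <= j) M i -> \bigoplus_i M i, with i and j in P. *)
Section Colimit.
Variables (R : pzRingType) (disp : Order.disp_t) (C : porderType disp).
Variables (M : pmodule R C) (P : set C).

Definition colim_sum : lmodType R := dsum (fun i : P => M (val i)).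

Definition colim_rel : set colim_sum :=
  [set z | exists (i j : P) (ij : (val i <= val j)%O) (x : M (val i)),
     z = dsum_in (M := fun i : P => M (val i)) (i := i) x
         - dsum_in (M := fun i : P => M (val i)) (i := j) (pm_map M ij x)].

Definition colim : lmodType R := lmod_quot colim_rel.

Definition colim_in (i : P) (x : M (val i)) : colim :=
  lmod_pi colim_rel (dsum_in (M := fun i : P => M (val i)) x).

Fact colim_in_linear i : linear (@colim_in i).
Proof. by move=> a x y; rewrite /colim_in !linearP. Qed.
HB.instance Definition _ i :=
  GRing.isLinear.Build R (M (val i)) colim *:%R (@colim_in i)
    (@colim_in_linear i).

Lemma colim_in_map (i j : P) (ij : (val i <= val j)%O) x :
  @colim_in j (pm_map M ij x) = @colim_in i x.
Proof.
apply/esym/lmod_pi_eq/lmod_span_gen; by exists i, j, ij, x.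
Qed.

Section Desc.
Variables (N : lmodType R) (f : forall i : P, {linear M (val i) -> N}).
Hypothesis f_compat : forall (i j : P) (ij : (val i <= val j)%O) x,
  f j (pm_map M ij x) = f i x.

Definition colim_desc (q : colim) : N :=
  dsum_desc f (repr (q : Quotient.quot (lmod_span colim_rel))).

Lemma colim_desc_pi z : colim_desc (lmod_pi colim_rel z) = dsum_desc f z.
Proof.
apply/eqP; rewrite -subr_eq0 -linearB; apply/eqP.
set y := _ - z.
have : y \in lmod_span colim_rel by apply/lmod_pi_eq; rewrite lmod_piK.
move/asboolP => /(_ (fun y => dsum_desc f y == 0)) H; apply/eqP/H.
  split=> [|a u v /eqP u0 /eqP v0]; first by rewrite unfold_in linear0.
  by rewrite unfold_in linearP /= u0 v0 scaler0 addr0.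
move=> g; rewrite inE => -[i [j [ij [x ->]]]].
by rewrite unfold_in linearB /= !dsum_desc_in f_compat subrr.
Qed.

Fact colim_desc_linear : linear colim_desc.
Proof.
move=> a p q; rewrite -[p]lmod_piK -[q]lmod_piK -linearP !colim_desc_pi.
by rewrite linearP.
Qed.

Definition colim_desc_lin : {linear colim -> N} :=
  HB.pack colim_desc
    (GRing.isLinear.Build R colim N *:%R colim_desc colim_desc_linear).

Lemma colim_desc_in i (x : M (val i)) : colim_desc_lin (colim_in x) = f i x.
Proof. by rewrite /= colim_desc_pi dsum_desc_in. Qed.
End Desc.

Lemma colim_ext (N : lmodType R) (g h : {linear colim -> N}) :
  (forall i (x : M (val i)), g (colim_in x) = h (colim_in x)) -> g =1 h.
Proof.
move=> gh q; rewrite -[q]lmod_piK; move: (repr _) => z.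
apply: (@dsum_ext _ _ _ _ (g \o @lmod_pi _ _ colim_rel)
                          (h \o @lmod_pi _ _ colim_rel)) => i x.
exact: gh.
Qed.

Section Canonical.
Variables (c : C) (Pc : P `<=` [set d | (d <= c)%O]).

Definition colim_leg (i : P) : {linear M (val i) -> M c} :=
  pm_map M (Pc (set_mem (valP i))).

Fact colim_leg_compat (i j : P) (ij : (val i <= val j)%O) x :
  colim_leg j (pm_map M ij x) = colim_leg i x.
Proof. exact/esym/pm_map_comp. Qed.

Definition colim_can : {linear colim -> M c} := colim_desc_lin colim_leg_compat.
End Canonical.

End Colimit.

Section Morphisms.
Variables (R : pzRingType) (V W : lmodType R).
Implicit Types f : {linear V -> W}.

Definition is_epi f := forall (N : lmodType R) (g h : {linear W -> N}),
  g \o f =1 h \o f -> g =1 h.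
Definition is_mono f := forall (N : lmodType R) (g h : {linear N -> V}),
  f \o g =1 f \o h -> g =1 h.
Definition is_iso f := exists g : {linear W -> V}, cancel f g /\ cancel g f.

Lemma is_epiP f : is_epi f <-> (forall y, exists x, f x = y).
Proof.
split=> [epif y|surjf N g h gh y]; last first.
  by have [x <-] := surjf y; exact: gh.
pose p := @lmod_pi R W (range f).
have p0 : p =1 (\0 : {linear W -> lmod_quot (range f)}).
  apply: (epif _ p) => x; rewrite /= -(linear0 p); apply/lmod_pi_eq.
  by rewrite subr0; apply: lmod_span_gen; exists x.
have : y \in lmod_span (range f).
  by have := p0 y; rewrite /= -(linear0 p) => /lmod_pi_eq; rewrite subr0.
move/asboolP => /(_ (fun y => `[< exists x, f x = y >])) H; apply/asboolP/H.
  split=> [|a u v /asboolP[x1 <-] /asboolP[x2 <-]]; apply/asboolP.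
    by exists 0; rewrite linear0.
  by exists (a *: x1 + x2); rewrite linearP.
by move=> g; rewrite inE => -[x _ <-]; apply/asboolP; exists x.
Qed.

End Morphisms.

Lemma is_monoP (R : comPzRingType) (V W : lmodType R) (f : {linear V -> W}) :
  is_mono f <-> injective f.
Proof.
split=> [monof x y fxy|injf N g h gh z]; last exact/injf/gh.
have lin (v : V) : linear (fun a : R^o => a *: v).
  by move=> a b c; rewrite scalerDl scalerA.
pose s v : {linear R^o -> V} :=
  HB.pack (fun a : R^o => a *: v) (GRing.isLinear.Build R R^o V *:%R _ (lin v)).
have fs : f \o s x =1 f \o s y by move=> a /=; rewrite !linearZ fxy.
by have := monof R^o _ _ fs 1; rewrite /= !scale1r.
Qed.

Section Presentation.
Variables (R : comPzRingType) (disp : Order.disp_t) (C : porderType disp).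
Implicit Types (S T : set C) (M : pmodule R C) (c : C).

Definition presented T M := forall c,
  is_iso (@colim_can R disp C M [set d | T d /\ (d <= c)%O] c
            (fun d Td => proj2 Td)).

Definition lambda S M c :
    {linear colim M [set d | (d < c)%O /\ S d] -> M c} :=
  @colim_can R disp C M [set d | (d < c)%O /\ S d] c
    (fun d dc => ltW (proj1 dc)).

Definition births S M : set C := [set c | ~ is_epi (lambda S M c)].
Definition deaths S M : set C := [set c | ~ is_mono (lambda S M c)].

Definition artinian S :=
  ~ exists u : nat -> C, (forall n, S (u n)) /\ (forall n, (u n.+1 < u n)%O).

End Presentation.

Definition is_minimum (T : Type) (E : set (set T)) (A : set T) :=
  E A /\ (forall B, E B -> A `<=` B).

(* Main.v *)
(** Say that [M] is [T]-presented at [c] if it is the colimit of its values on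
    the elements of [T] below [c].  If [M] is [T]-presented at every element of
    a set [Q] of elements below [c], and [Q] contains all elements of [T] below
    [c], then the colimits over [Q] and over [T] below [c] agree.  Taking [Q] to
    be the elements of [S] strictly below [c], an induction on the Artinian
    poset [S] shows that [M] is presented by births and deaths at every [c] in
    [S]; taking the elements of [S] below [c] gives all other [c].  Conversely,
    if [M] is [T]-presented and [c] is not in [T], the elements of [S] strictly
    below [c] contain all elements of [T] below [c], so [lambda] is an
    isomorphism at [c]. *)

From HB Require Import structures.
Require Import Defs.
From mathcomp Require Import all_boot all_order all_algebra.
From mathcomp Require Import boolp classical_sets.

Set Implicit Arguments.
Unset Strict Implicit.
Unset Printing Implicit Defensive.

Import Order.TTheory GRing.Theory.
Local Open Scope classical_set_scope.
Local Open Scope ring_scope.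

(** * Isomorphisms of modules, and Artinian induction *)

Section LinearIso.
Variables (R : pzRingType) (U V W : lmodType R).

Lemma is_iso_comp (f : {linear U -> V}) (g : {linear V -> W})
    (h : {linear U -> W}) :
  (forall x, h x = g (f x)) -> is_iso f -> is_iso g -> is_iso h.
Proof.
move=> hE [f' [fK f'K]] [g' [gK g'K]]; exists (f' \o g').
by split=> x; rewrite /= hE /= ?gK ?fK ?f'K ?g'K.
Qed.

Lemma is_iso_inv (f : {linear U -> V}) (g : {linear V -> U}) :
  cancel f g -> cancel g f -> is_iso g.
Proof. by move=> fK gK; exists f. Qed.

Lemma is_iso_epi (f : {linear U -> V}) : is_iso f -> is_epi f.
Proof. by case=> g [_ gK]; apply/is_epiP => y; exists (g y). Qed.

End LinearIso.

Lemma is_iso_mono (R : comPzRingType) (U V : lmodType R)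
  (f : {linear U -> V}) : is_iso f -> is_mono f.
Proof. by case=> g [fK _]; apply/is_monoP/(can_inj fK). Qed.

(** Preimages chosen pointwise give a right inverse [g]; injectivity of [f] makes it linear and
    two-sided. *)
Lemma is_iso_epi_mono (R : comPzRingType) (U V : lmodType R)
  (f : {linear U -> V}) : is_epi f -> is_mono f -> is_iso f.
Proof.
move=> /is_epiP/choice[g gK] /is_monoP injf.
have lin_g : linear g by move=> a x y; apply: injf; rewrite linearP !gK.
pose g' : {linear V -> U} :=
  HB.pack g (GRing.isLinear.Build R V U *:%R g lin_g).
by exists g'; split=> [x|y]; [apply: injf | ]; rewrite /= gK.
Qed.

(** Below each counterexample in [S] lies a strictly smaller one, so iterating a choice of these
    gives an infinite descending chain. *)
Lemma artinian_ind (disp : Order.disp_t) (C : porderType disp) (S P : set C) :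
  artinian S ->
  (forall c, S c -> (forall d, S d -> (d < c)%O -> P d) -> P c) -> S `<=` P.
Proof.
move=> artS step c Sc; apply: contrapT => nPc; apply: artS.
pose bad := {d | S d /\ ~ P d}.
have next (x : bad) : exists y : bad, (sval y < sval x)%O.
  case: x => x [Sx nPx] /=; apply: contrapT => none; apply: nPx.
  apply: step => // d Sd dx; apply: contrapT => nPd; apply: none.
  by exists (exist _ d (conj Sd nPd)).
have [f fP] := choice next.
pose u n := iter n f (exist _ c (conj Sc nPc)).
exists (fun n => sval (u n)); split=> n; last exact: fP.
by case: (svalP (u n)).
Qed.

(** * Functoriality of colimits in the index subposet *)

Section ColimitInclusion.
Variables (R : pzRingType) (disp : Order.disp_t) (C : porderType disp).
Variable M : pmodule R C.
Implicit Types (P Q : set C) (c d : C).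

(** Separating the element from its membership proof lets the same [d] index colimits over different
    subsets without subtype coercions. *)
Definition colim_at P d (Pd : P d) (x : M d) : colim M P :=
  @colim_in R disp C M P (exist _ d (mem_set Pd)) x.

Fact colim_at_linear P d (Pd : P d) : linear (colim_at Pd).
Proof. exact: (colim_in_linear (i := exist _ d (mem_set Pd))). Qed.
HB.instance Definition _ P d (Pd : P d) :=
  GRing.isLinear.Build R (M d) (colim M P) *:%R (colim_at Pd)
    (colim_at_linear Pd).

Lemma colim_inE P (i : P) (Pi : P (val i)) (x : M (val i)) :
  colim_in x = colim_at Pi x.
Proof.
case: i Pi x => d dP Pd x; rewrite /colim_at.
by rewrite (Prop_irrelevance (mem_set Pd) dP).
Qed.

Lemma colim_at_map P c d (Pc : P c) (Pd : P d) (cd : (c <= d)%O) x :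
  colim_at Pd (pm_map M cd x) = colim_at Pc x.
Proof.
exact: (@colim_in_map _ _ _ M P (exist _ c (mem_set Pc)) (exist _ d (mem_set Pd))).
Qed.

(** Checks commutativity of a square on generators; with [idfun] on one side it also handles
    triangles and inverses. *)
Lemma colim_at_ext2 P (V W N : lmodType R)
    (f : {linear V -> N}) (f' : {linear W -> N})
    (g : {linear colim M P -> V}) (g' : {linear colim M P -> W}) :
  (forall d (Pd : P d) (x : M d),
    f (g (colim_at Pd x)) = f' (g' (colim_at Pd x))) ->
  forall q, f (g q) = f' (g' q).
Proof.
move=> fg; apply: (colim_ext (g := f \o g) (h := f' \o g')) => i x.
rewrite (colim_inE (set_mem (valP i))); exact: fg.
Qed.

Lemma colim_at_cancel P (V : lmodType R)
    (f : {linear V -> colim M P}) (g : {linear colim M P -> V}) :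
  (forall d (Pd : P d) (x : M d), f (g (colim_at Pd x)) = colim_at Pd x) ->
  cancel g f.
Proof. by move=> fg; apply: (colim_at_ext2 (f' := idfun) (g' := idfun)). Qed.

Lemma colim_can_at P c (Pc : P `<=` [set d | (d <= c)%O]) d (Pd : P d)
    (dc : (d <= c)%O) x :
  colim_can M Pc (colim_at Pd x) = pm_map M dc x.
Proof.
rewrite /colim_can colim_desc_in /colim_leg /=.
by congr (pm_map M _ x); exact: Prop_irrelevance.
Qed.

Section Desc.
Variables (P : set C) (N : lmodType R).
Variable f : forall d, P d -> {linear M d -> N}.
Hypothesis f_compat : forall c d (Pc : P c) (Pd : P d) (cd : (c <= d)%O) x,
  f Pd (pm_map M cd x) = f Pc x.

Lemma colim_at_desc : exists g : {linear colim M P -> N},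
  forall d (Pd : P d) x, g (colim_at Pd x) = f Pd x.
Proof.
pose F (i : P) := f (set_mem (valP i)).
have FE (i j : P) (ij : (val i <= val j)%O) x : F j (pm_map M ij x) = F i x.
  exact: f_compat.
exists (colim_desc_lin FE) => d Pd x.
rewrite colim_desc_in /F /=.
by congr (f _ x); exact: Prop_irrelevance.
Qed.

End Desc.

Lemma colim_incl_exists P Q (PQ : P `<=` Q) :
  exists g : {linear colim M P -> colim M Q},
  forall d (Pd : P d) x, g (colim_at Pd x) = colim_at (PQ d Pd) x.
Proof.
by apply: (colim_at_desc (f := fun d Pd => colim_at (PQ d Pd))) => *;
  exact: colim_at_map.
Qed.

Definition colim_incl P Q (PQ : P `<=` Q) := sval (cid (colim_incl_exists PQ)).

Lemma colim_incl_at P Q (PQ : P `<=` Q) d (Pd : P d) (Qd : Q d) x :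
  colim_incl PQ (colim_at Pd x) = colim_at Qd x.
Proof.
rewrite /colim_incl; case: cid => /= g ->.
by rewrite (Prop_irrelevance (PQ d Pd) Qd).
Qed.

(** Naturality of the canonical map, in the index subset and in the target at once. *)
Lemma colim_can_incl P Q c d (Pc : P `<=` [set e | (e <= c)%O])
    (Qd : Q `<=` [set e | (e <= d)%O]) (PQ : P `<=` Q) (cd : (c <= d)%O) q :
  colim_can M Qd (colim_incl PQ q) = pm_map M cd (colim_can M Pc q).
Proof.
apply: colim_at_ext2 q => e Pe x.
have ec : (e <= c)%O := Pc e Pe.
rewrite (colim_incl_at PQ Pe (PQ e Pe) x) (colim_can_at Pc Pe ec x).
by rewrite (colim_can_at Qd (PQ e Pe) (le_trans ec cd) x); exact: pm_map_comp.
Qed.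

Lemma colim_incl_comp P Q Q' (PQ : P `<=` Q) (QQ' : Q `<=` Q')
    (PQ' : P `<=` Q') q :
  colim_incl QQ' (colim_incl PQ q) = colim_incl PQ' q.
Proof.
apply: (colim_at_ext2 (f' := idfun)) q => e Pe x.
have Qe := PQ e Pe; have Q'e := QQ' e Qe.
rewrite (colim_incl_at PQ Pe Qe x) (colim_incl_at QQ' Qe Q'e x) /=.
by rewrite (colim_incl_at PQ' Pe Q'e x).
Qed.

End ColimitInclusion.
Arguments colim_at {R disp C} M {P d} Pd x.

(** * Pointwise presentation, cofinality, births and deaths *)

Section PresentedAt.
Variables (R : comPzRingType) (disp : Order.disp_t) (C : porderType disp).
Variable M : pmodule R C.
Implicit Types (Q S T : set C) (c d : C).

Definition below T c := [set d | T d /\ (d <= c)%O].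

Lemma below_le T c : below T c `<=` [set d | (d <= c)%O].
Proof. by move=> d []. Qed.

Definition presented_at T c := is_iso (colim_can M (@below_le T c)).

Lemma is_iso_colim_can Q Q' c (Qc : Q `<=` [set d | (d <= c)%O])
    (Qc' : Q' `<=` [set d | (d <= c)%O]) :
  Q = Q' -> is_iso (colim_can M Qc) -> is_iso (colim_can M Qc').
Proof.
by move=> QQ'; case: Q' / QQ' Qc' => Qc'; rewrite (Prop_irrelevance Qc Qc').
Qed.

Lemma presentedP T : presented T M <-> forall c, presented_at T c.
Proof. by split=> H c; apply: is_iso_colim_can (H c). Qed.

(** Here [c] is the greatest element of [below T c], so the colimit is attained at [c]. *)
Lemma presented_at_mem T c : T c -> presented_at T c.
Proof.
move=> Tc; have Bc : below T c c by split.
exists (colim_at M Bc); split=> [|x]; last first.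
  by rewrite (colim_can_at _ _ (lexx c) x) pm_map_id.
apply: colim_at_cancel => d Bd x.
by rewrite (colim_can_at _ _ (proj2 Bd) x); exact: colim_at_map.
Qed.

Section Cofinal.
Variables (T Q : set C) (c : C).
Hypotheses (Qc : Q `<=` [set d | (d <= c)%O]) (TQ : below T c `<=` Q).
Hypothesis presQ : forall d, Q d -> presented_at T d.

Lemma below_sub d : Q d -> below T d `<=` below T c.
Proof. by move=> /Qc dc e [Te ed]; split=> //; exact: le_trans dc. Qed.

(** The inverse is glued from maps out of [M d], for [d] in [Q]: first the inverse of the canonical
    map, given by [presQ], then the inclusion of colimits. *)
Lemma is_iso_colim_incl_below : is_iso (colim_incl M TQ).
Proof.
have /cid[g gP] : exists g : forall d, Q d -> {linear M d -> colim M (below T d)},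
    forall d (Qd : Q d), cancel (colim_can M (@below_le T d)) (g d Qd) /\
                         cancel (g d Qd) (colim_can M (@below_le T d)).
  exists (fun d Qd => sval (cid (presQ Qd))) => d Qd.
  by case: cid.
have canK d (Qd : Q d) := (gP d Qd).1; have gK d (Qd : Q d) := (gP d Qd).2.
pose f d (Qd : Q d) : {linear M d -> colim M (below T c)} :=
  colim_incl M (below_sub Qd) \o g d Qd.
have fE d e (Qd : Q d) (Qe : Q e) (de : (d <= e)%O) x :
    f e Qe (pm_map M de x) = f d Qd x.
  have sub : below T d `<=` below T e.
    by move=> t [Tt td]; split=> //; exact: le_trans de.
  (* Writing [x] as a canonical image turns transport along [de] into an inclusion of colimits,
     which [g e Qe] then recovers. *)
  rewrite -[in LHS](gK d Qd x).
  rewrite -(colim_can_incl (@below_le T d) (@below_le T e) sub de (g d Qd x)).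
  by rewrite /f /= canK; exact: colim_incl_comp.
have [phi phiE] := colim_at_desc fE.
exists phi; split.
  apply: colim_at_cancel => t Bt x.
  have Qt := TQ Bt; have Btt : below T t t by split=> //; case: Bt.
  rewrite (colim_incl_at TQ Bt Qt x) phiE /f /=.
  (* Since [t] is in [T], [x] is the canonical image of its own class at [t]. *)
  have -> : g t Qt x = colim_at M Btt x.
    by rewrite -[RHS](canK t Qt) (colim_can_at _ _ (lexx t) x) pm_map_id.
  exact: colim_incl_at.
apply: colim_at_cancel => d Qd x.
(* Each [x] in [M d] comes from the colimit over [below T d], so generators at elements of [T]
   suffice. *)
rewrite phiE /f /= -{2}(gK d Qd x); move: (g d Qd x) => {x}.
apply: colim_at_ext2 => t Bt x.
have Bct := below_sub Qd Bt; have Qt := TQ Bct.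
rewrite (colim_incl_at _ Bt Bct x) (colim_incl_at _ Bct Qt x).
by rewrite (colim_can_at _ _ (proj2 Bt) x); exact/esym/colim_at_map.
Qed.

(** The canonical map over [below T c] factors as the isomorphism [colim_incl M TQ] followed by the
    one over [Q]. *)
Lemma presented_atE : presented_at T c <-> is_iso (colim_can M Qc).
Proof.
have tri q : colim_can M (@below_le T c) q = colim_can M Qc (colim_incl M TQ q).
  have := colim_can_incl (@below_le T c) Qc TQ (lexx c) q.
  by rewrite /= pm_map_id.
have iso := is_iso_colim_incl_below.
split=> [isoT | ]; last exact: is_iso_comp iso.
case: iso => psi [inclK psiK].
apply: (is_iso_comp (f := psi) _ _ isoT) => [q|].
  by rewrite tri psiK.
exact: is_iso_inv inclK psiK.
Qed.

End Cofinal.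

Lemma lambda_iso S c :
  (births S M `|` deaths S M) c \/ is_iso (lambda S M c).
Proof.
have [e|ne] := pselect (is_epi (lambda S M c)); last by left; left.
have [m|nm] := pselect (is_mono (lambda S M c)); last by left; right.
by right; exact: is_iso_epi_mono.
Qed.

Lemma lambda_isoN S c :
  is_iso (lambda S M c) -> ~ (births S M `|` deaths S M) c.
Proof.
by move=> iso [nepi|nmono]; [apply/nepi/is_iso_epi | apply/nmono/is_iso_mono].
Qed.

Lemma births_deaths_min S T : T `<=` S -> presented T M ->
  births S M `|` deaths S M `<=` T.
Proof.
move=> TS /presentedP presT c BDc; apply: contrapT => nTc.
apply: lambda_isoN BDc; apply/presented_atE => // d [Td].
rewrite le_eqVlt => /predU1P[dc|dc]; first by rewrite dc in Td.
by split=> //; exact: TS.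
Qed.

Lemma births_deaths_presented S : artinian S -> presented S M ->
  presented (births S M `|` deaths S M) M.
Proof.
(* Minimality against [S] itself puts all births and deaths in [S]. *)
move=> artS presS; have BDS := births_deaths_min (@subset_refl _ S) presS.
set T := _ `|` _ in BDS *.
have presST : S `<=` presented_at T.
  apply: artinian_ind artS _ => c Sc IH.
  have [Tc|iso] := lambda_iso S c; first exact: presented_at_mem.
  have [Tc|nTc] := pselect (T c); first exact: presented_at_mem.
  (* With [c] outside [T], this inclusion makes cofinality applicable to the domain of [lambda]. *)
  suff TQ : below T c `<=` [set d | (d < c)%O /\ S d].
    by apply: (presented_atE _ TQ _).2 iso => d [dc Sd]; exact: IH.
  move=> d [Td]; rewrite le_eqVlt => /predU1P[dc|dc].
    by rewrite dc in Td.
  by split=> //; exact: BDS.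
have TQ c : below T c `<=` below S c by move=> d [/BDS Sd dc].
apply/presentedP => c; apply: (presented_atE _ (TQ c) _).2 (presS c) => d [].
by move=> /presST.
Qed.

End PresentedAt.

Theorem proposition3p25 (R : comPzRingType) (disp : Order.disp_t)
    (C : porderType disp) (M : pmodule R C) (S : set C)
    (artS : artinian S) (presS : presented S M) :
  presented (births S M `|` deaths S M) M /\
  is_minimum [set T : set C | T `<=` S /\ presented T M]
    (births S M `|` deaths S M).
Proof.
have presBD := births_deaths_presented artS presS.
split=> //; split=> [|T [TS presT]]; last exact: births_deaths_min.
by split=> //; exact: births_deaths_min.
Qed.
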